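(* Assume Markov's principle, and assume that for all sets $A$ and $B$ which both have the $\neg\neg$ strong Myhill property, either $A + B$ or $A \times B$ has the $\neg\neg$ Myhill property. Then excluded middle holds (i.e. $p \vee \neg p$ for every $p \in \Omega$).
   Context: The statement is to be proved constructively (intuitionistic set theory with powersets and $\mathbb{N}$, equivalently the internal logic of a topos with natural numbers object; neither excluded middle nor choice is assumed). $\Omega = \mathcal{P}(1)$ is the set of truth values; $+$ is disjoint union. Markov's principle: for every $p \in 2^{\mathbb{N}}$, if $p \neq 0^\omega$ (the constant $0$ sequence), then there exists $n$ with $p_n = 1$. A subset $A \subseteq X$ is $\neg\neg$-stable if for all $x \in X$, $\neg\neg(x \in A)$ implies $x \in A$. A set $X$ has the $\neg\neg$ Myhill property if for all $\neg\neg$-stable subsets $A, B \subseteq X$: if there are injections $f, g : X \to X$ with $A = f^{-1}(B)$ and $B = g^{-1}(A)$, then there is a bijection $h : X \to X$ which restricts to a bijection between $A$ and $B$. For injections $f, g : X \to X$ and $m \in \mathbb{Z}$, let $R^{f,g}_m \subseteq X \times X$ be the partial injection $f \circ (g \circ f)^m$: for $m \ge 0$, $(x,y) \in R^{f,g}_m$ iff $y = f((g\circ f)^m(x))$; for $m < 0$, $(x,y) \in R^{f,g}_m$ iff $x = g((f \circ g)^{-m-1}(y))$. A set $X$ has the $\neg\neg$ strong Myhill property if for every pair of injections $f, g : X \to X$ there is a bijection $h : X \to X$ such that for every $x \in X$, $\neg\neg\, \exists m \in \mathbb{Z}.\ (x,h(x)) \in R^{f,g}_m$. *)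

(* Defs.v *)
From mathcomp Require Import all_boot.
From mathcomp Require Import ssrint.

Set Implicit Arguments.
Unset Strict Implicit.
Unset Printing Implicit Defensive.

(* Constructive mathematics is carried out directly in Rocq's own logic: sets
   are types, the set of truth values is [Prop], subsets of [X] are predicates
   [X -> Prop] compared extensionally, and functions are Rocq functions. No
   axiom is assumed here; in particular, the notions below are meant to be used
   without excluded middle or choice, and Myhill-type properties that are
   trivial classically are not so in this setting. *)

(* [p <> 0^omega] is read with extensional equality of sequences, so that the
   statement does not depend on functional extensionality. *)
Definition markov_principle : Prop :=
  forall p : nat -> bool, ~ (p =1 fun=> false) -> exists n, p n = true.

Definition nn_stable (X : Type) (A : X -> Prop) : Prop :=
  forall x, ~ ~ A x -> A x.

Definition is_preimage (X Y : Type) (f : X -> Y) (B : Y -> Prop)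
    (A : X -> Prop) : Prop :=
  forall x, A x <-> B (f x).

Definition restricts_to_bijection (X Y : Type) (h : X -> Y)
    (A : X -> Prop) (B : Y -> Prop) : Prop :=
  [/\ forall x, A x -> B (h x),
      forall x x', A x -> A x' -> h x = h x' -> x = x'
    & forall y, B y -> exists2 x, A x & h x = y].

Definition nn_myhill (X : Type) : Prop :=
  forall A B : X -> Prop, nn_stable A -> nn_stable B ->
  forall f g : X -> X, injective f -> injective g ->
  is_preimage f B A -> is_preimage g A B ->
  exists h : X -> X, bijective h /\ restricts_to_bijection h A B.

(* The partial injection f o (g o f)^m, as a relation from [x] to [y].
   [Negz n] is the integer m = - (n + 1), for which - m - 1 = n. *)
Definition myhill_rel (X : Type) (f g : X -> X) (m : int) (x y : X) : Prop :=
  match m with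
  | Posz n => y = f (iter n (g \o f) x)
  | Negz n => x = g (iter n (f \o g) y)
  end.

Definition nn_strong_myhill (X : Type) : Prop :=
  forall f g : X -> X, injective f -> injective g ->
  exists h : X -> X, bijective h /\
    forall x, ~ ~ exists m : int, myhill_rel f g m x (h x).

(* Main.v *)
Require Import Defs.
From mathcomp Require Import all_boot.
From mathcomp Require Import ssrint.
From Stdlib Require Import ProofIrrelevance.

Set Implicit Arguments.
Unset Strict Implicit.
Unset Printing Implicit Defensive.

(* Fix a proposition [P] and take [A = P + 1] and [B = nat]. Every injection of
   [A] into itself is a bijection, and [nat] satisfies the strong Myhill
   property by Myhill's back-and-forth argument. Both [A + B] and [A * B] contain
   decidable subsets [S] and [T], reducible to each other by injections, such
   that [T] is a copy of [nat] and [S] is [T] plus a point that exists exactly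
   when [P] holds. If [h] is a bijection carrying [S] to [T], then [P] holds if
   and only if [h^-1] maps some element of [T] to that extra point; so [P] is
   semi-decidable, hence stable under double negation by Markov's principle.
   Stability of [p \/ ~ p] is excluded middle. Proof irrelevance is what makes
   [P] a subset of a singleton; no classical axiom is involved. *)

(** * Orbits of a pair of injections *)

Section Orbits.

Variables (X Y : Type) (f : X -> Y) (g : Y -> X).

(** Gluing [f] and [g] into one self-map of the disjoint union turns the alternating chains x,
    [f x], [g (f x)], ... into forward orbits. *)
Definition step (s : X + Y) : X + Y :=
  match s with inl x => inr (f x) | inr y => inl (g y) end.

Definition same_orbit (s t : X + Y) : Prop :=
  exists n, iter n step s = t \/ iter n step t = s.

Lemma same_orbit_sym s t : same_orbit s t -> same_orbit t s.
Proof. by case=> n [e|e]; exists n; [right | left]. Qed.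

Lemma same_orbit_step s : same_orbit s (step s).
Proof. by exists 1; left. Qed.

Hypotheses (f_inj : injective f) (g_inj : injective g).

Lemma step_inj : injective step.
Proof.
by move=> [x|y] [x'|y'] //= [] => [/f_inj -> | /g_inj ->].
Qed.

Lemma iter_step_inj n : injective (iter n step).
Proof. by elim: n => [//|n IHn] s t /= /step_inj /IHn. Qed.

Lemma same_orbit_of_iter m n s t :
  iter m step s = iter n step t -> same_orbit s t.
Proof.
case/orP: (leq_total m n) => le_mn e.
  exists (n - m); right; apply: (@iter_step_inj m).
  by rewrite -iterD subnKC.
exists (m - n); left; apply: (@iter_step_inj n).
by rewrite -iterD subnKC.
Qed.

Lemma same_orbit_trans t s u :
  same_orbit s t -> same_orbit t u -> same_orbit s u.
Proof.
case=> m [<-|<-] [n [<-|e]].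
- by exists (n + m); left; rewrite iterD.
- by apply/same_orbit_sym/(@same_orbit_of_iter n m).
- by apply: (@same_orbit_of_iter n m); rewrite -!iterD addnC.
- by exists (m + n); right; rewrite iterD e.
Qed.

End Orbits.

Lemma iter_step_even (X : Type) (f g : X -> X) k x :
  iter k.*2 (step f g) (inl x) = inl (iter k (g \o f) x).
Proof. by elim: k => //= k ->. Qed.

Lemma iter_step_even_r (X : Type) (f g : X -> X) k y :
  iter k.*2 (step f g) (inr y) = inr (iter k (f \o g) y).
Proof. by elim: k => //= k ->. Qed.

(** Each step changes sides, so a path between the two sides has odd length 2k+1. A path from [x] to
    [y] gives the exponent [Posz k], one from [y] to [x] gives [Negz k]. *)
Lemma same_orbit_myhill_rel (X : Type) (f g : X -> X) x y :
  same_orbit f g (inl x) (inr y) -> exists m : int, myhill_rel f g m x y.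
Proof.
case=> n; rewrite -(odd_double_half n); case: (odd n) => [] [];
  rewrite ?add1n ?add0n ?iterS ?iter_step_even ?iter_step_even_r //= => - [].
- by move=> <-; exists (Posz n./2).
- by move=> <-; exists (Negz n./2).
Qed.

(** * Finite partial matchings *)

Lemma unzip1_functional (X Y : eqType) (l : seq (X * Y)) x y y' :
  uniq (unzip1 l) -> (x, y) \in l -> (x, y') \in l -> y = y'.
Proof.
elim: l => // -[a b] l IHl /= /andP[a_l uniq_l].
rewrite !inE => /orP[/eqP[ex ey]|xy_l] /orP[/eqP[ex' ey']|xy'_l].
- by rewrite ey ey'.
- by case/negP: a_l; apply/mapP; exists (x, y').
- by case/negP: a_l; apply/mapP; exists (x, y).
- exact: IHl.
Qed.

Lemma unzip2_functional (X Y : eqType) (l : seq (X * Y)) x x' y :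
  uniq (unzip2 l) -> (x, y) \in l -> (x', y) \in l -> x = x'.
Proof.
elim: l => // -[a b] l IHl /= /andP[b_l uniq_l].
rewrite !inE => /orP[/eqP[ex ey]|xy_l] /orP[/eqP[ex' ey']|xy'_l].
- by rewrite ex ex'.
- by case/negP: b_l; apply/mapP; exists (x', y).
- by case/negP: b_l; apply/mapP; exists (x, y).
- exact: IHl.
Qed.

(** Decidable equality lets the list be searched. The result is a sigma type, so that a function can
    later be read off without choice. *)
Lemma unzip1_partner (X Y : eqType) (l : seq (X * Y)) x :
  x \in unzip1 l -> {y | (x, y) \in l}.
Proof.
elim: l => // -[a b] l IHl; rewrite /= inE.
case: eqP => [-> _|_ /IHl[y xy]]; first by exists b; rewrite inE eqxx.
by exists y; rewrite inE xy orbT.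
Qed.

Lemma unzip2_partner (X Y : eqType) (l : seq (X * Y)) y :
  y \in unzip2 l -> {x | (x, y) \in l}.
Proof.
elim: l => // -[a b] l IHl; rewrite /= inE.
case: eqP => [-> _|_ /IHl[x xy]]; first by exists a; rewrite inE eqxx.
by exists x; rewrite inE xy orbT.
Qed.

(** These are the difunctional relations: what an equivalence relation on [X + Y] leaves between the
    two summands. *)
Definition zigzag (X Y : Type) (E : X -> Y -> Prop) : Prop :=
  forall x y x' y', E x y -> E x' y -> E x' y' -> E x y'.

Definition partial_matching (X Y : eqType) (E : X -> Y -> Prop)
    (l : seq (X * Y)) : Prop :=
  [/\ uniq (unzip1 l), uniq (unzip2 l) & forall x y, (x, y) \in l -> E x y].

(* If [f x] is already matched, to [x'] say, drop the pair [(x', f x)] and look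
   for a partner of [x'] instead. The partner found is the image under [f] of a
   point other than [x], hence differs from [f x]. *)
Lemma matching_free_partner (X Y : eqType) (E : X -> Y -> Prop) (f : X -> Y) :
  injective f -> (forall x, E x (f x)) -> zigzag E ->
  forall l x, partial_matching E l -> x \notin unzip1 l ->
  {y | [/\ y \notin unzip2 l, E x y & y \in map f (x :: unzip1 l)]}.
Proof.
move=> f_inj Ef zzE l.
have [n le_ln] := ubnP (size l).
elim: n l le_ln => // n IHn l le_ln x [u1 u2 El] xl.
have [fx_l|fx_l] := boolP (f x \in unzip2 l); last first.
  by exists (f x); rewrite inE eqxx.
have [x' x'l] := unzip2_partner fx_l.
set l' := rem (x', f x) l.
have perm_l : perm_eq l ((x', f x) :: l') by exact: perm_to_rem.
have := perm_uniq (perm_map fst perm_l); rewrite -/(unzip1 l) u1 /=.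
case/esym/andP=> x'l' u1'.
have := perm_uniq (perm_map snd perm_l); rewrite -/(unzip2 l) u2 /=.
case/esym/andP=> fxl' u2'.
have sub1 : {subset x' :: unzip1 l' <= unzip1 l}.
  by move=> z; rewrite (perm_mem (perm_map fst perm_l)).
case: (IHn l' _ x' _ x'l') => [||y [y_l' Exy y_im]].
- by move: le_ln; rewrite (perm_size perm_l).
- by split=> // a b /mem_rem /El.
exists y; split.
- rewrite (perm_mem (perm_map snd perm_l)) /= inE negb_or y_l' andbT.
  apply/eqP=> ey; move: y_im; rewrite ey => /mapP[z z_l' /f_inj ez].
  by case/negP: xl; rewrite ez; apply: sub1.
- exact: zzE (Ef x) (El _ _ x'l) Exy.
- case/mapP: y_im => z /sub1 zl ->.
  by rewrite inE map_f ?orbT.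
Qed.

Definition swap_pair (X Y : Type) (u : X * Y) : Y * X := (u.2, u.1).

Lemma partial_matching_swap (X Y : eqType) (E : X -> Y -> Prop) l :
  partial_matching E l ->
  partial_matching (fun y x => E x y) (map (@swap_pair X Y) l).
Proof.
case=> u1 u2 El; split; rewrite /unzip1 /unzip2 -?map_comp //.
by move=> y x /mapP[[a b] /El Eab [-> ->]].
Qed.

(** One forth step along [f], then one back step, which is the forth step along [g] for the
    transposed matching. *)
Lemma matching_extend (X : eqType) (E : X -> X -> Prop) (f g : X -> X) :
  injective f -> injective g -> (forall x, E x (f x)) ->
  (forall y, E (g y) y) -> zigzag E ->
  forall l x, partial_matching E l ->
  {l' | [/\ partial_matching E l', {subset l <= l'},
            x \in unzip1 l' & x \in unzip2 l']}.
Proof.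
move=> f_inj g_inj Ef Eg zzE l x El.
have [l1 [El1 sub1 xl1]] : {l1 | [/\ partial_matching E l1, {subset l <= l1}
                                   & x \in unzip1 l1]}.
  have [xl|xl] := boolP (x \in unzip1 l); first by exists l; split.
  have [y [yl Exy _]] := matching_free_partner f_inj Ef zzE El xl.
  exists ((x, y) :: l); split=> [|u ul|].
  - case: El => u1 u2 El; split; rewrite /= ?xl ?yl //.
    by move=> a b; rewrite inE => /orP[/eqP[-> ->]|/El].
  - by rewrite inE ul orbT.
  - by rewrite inE eqxx.
have [xl|xl] := boolP (x \in unzip2 l1); first by exists l1; split.
have zzE' : zigzag (fun y x => E x y) by move=> a b c d ? ? /zzE; apply; eauto.
have swap1 : unzip1 (map (@swap_pair X X) l1) = unzip2 l1.
  by rewrite /unzip1 -map_comp.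
have swap2 : unzip2 (map (@swap_pair X X) l1) = unzip1 l1.
  by rewrite /unzip2 -map_comp.
have [|y []] := @matching_free_partner _ _ _ g g_inj Eg zzE' _ x
                  (partial_matching_swap El1).
  by rewrite swap1.
rewrite swap2 => yl Exy _.
exists ((y, x) :: l1); split=> [|u /sub1 ul||].
- case: El1 => u1 u2 El1; split; rewrite /= ?xl ?yl //.
  by move=> a b; rewrite inE => /orP[/eqP[-> ->]|/El1].
- by rewrite inE ul orbT.
- by rewrite inE xl1 orbT.
- by rewrite inE eqxx.
Qed.

(** * The strong Myhill property of the two factors *)

Lemma back_and_forth (E : nat -> nat -> Prop) (f g : nat -> nat) :
  injective f -> injective g -> (forall x, E x (f x)) ->
  (forall y, E (g y) y) -> zigzag E ->
  exists h : nat -> nat, bijective h /\ forall x, E x (h x).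
Proof.
move=> f_inj g_inj Ef Eg zzE.
have ext := matching_extend f_inj g_inj Ef Eg zzE.
have E0 : partial_matching E [::] by [].
(* Stage [n] matches every number below [n] on both sides. *)
pose fix build n : {l | partial_matching E l} :=
  match n with
  | 0 => exist _ [::] E0
  | n.+1 => let: exist l El := build n in
            let: exist l' P := ext l n El in
            exist _ l' (let: And4 El' _ _ _ := P in El')
  end.
pose st n := sval (build n).
have Est n : partial_matching E (st n) by rewrite /st; case: (build n).
have stS n : [/\ {subset st n <= st n.+1}, n \in unzip1 (st n.+1)
               & n \in unzip2 (st n.+1)].
  rewrite /st /=; case: (build n) => l El.
  by case: (ext l n El) => l' [].
have st_mono m n : m <= n -> {subset st m <= st n}.
  elim: n => [|n IHn]; first by rewrite leqn0 => /eqP ->.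
  rewrite leq_eqVlt => /orP[/eqP -> //|/IHn sub u /sub].
  by case: (stS n) => + _ _; apply.
have hP n : {y | (n, y) \in st n.+1}.
  by apply: unzip1_partner; case: (stS n).
have kP n : {x | (x, n) \in st n.+1}.
  by apply: unzip2_partner; case: (stS n).
exists (fun n => sval (hP n)); split; last first.
  by move=> n; case: (hP n) => y /=; case: (Est n.+1) => _ _; apply.
exists (fun n => sval (kP n)) => n.
- case: (hP n) => y /= ny; case: (kP y) => x /= xy.
  (* Both pairs occur in one common stage, where second entries are distinct. *)
  have [_ u2 _] := Est (maxn n.+1 y.+1).
  by apply: unzip2_functional u2 _ _; [apply: st_mono xy | apply: st_mono ny];
    rewrite ?leq_maxl ?leq_maxr.
- case: (kP n) => x /= xn; case: (hP x) => y /= xy.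
  have [u1 _ _] := Est (maxn n.+1 x.+1).
  by apply: unzip1_functional u1 _ _; [apply: st_mono xy | apply: st_mono xn];
    rewrite ?leq_maxl ?leq_maxr.
Qed.

Lemma nat_nn_strong_myhill : nn_strong_myhill nat.
Proof.
move=> f g f_inj g_inj.
have [|||h [h_bij Eh]] := @back_and_forth
    (fun x y => same_orbit f g (inl x) (inr y)) f g f_inj g_inj.
- by move=> x; apply: (same_orbit_step f g (inl x)).
- by move=> y; apply/same_orbit_sym/(same_orbit_step f g (inr y)).
- move=> x y x' y' xy x'y x'y'.
  apply: same_orbit_trans xy _ => //.
  by apply: same_orbit_trans x'y' => //; apply: same_orbit_sym.
by exists h; split=> // x; apply; apply: same_orbit_myhill_rel.
Qed.

(** The value of [f None] can be inspected: either [f] exchanges [None] with the only possible other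
    point, or it is the identity. In both cases [f] is an involution, and serves as the bijection
    with exponent 0. *)
Lemma option_nn_strong_myhill (T : Type) :
  (forall u v : T, u = v) -> nn_strong_myhill (option T).
Proof.
move=> T_irr f g f_inj _; exists f; split; last first.
  by move=> x; apply; exists (Posz 0).
suff fK : involutive f by exists f.
case fN: (f None) => [u|].
  have fS v : f (Some v) = None.
    by case fv: (f (Some v)) => [w|//]; move: fv; rewrite (T_irr w u) -fN => /f_inj.
  by move=> [v|]; rewrite ?fS ?fN ?fS // (T_irr v u).
have fS v : f (Some v) = Some v.
  by case fv: (f (Some v)) => [w|]; [rewrite (T_irr w v) | move: fv; rewrite -fN => /f_inj].
by move=> [v|]; rewrite ?fS ?fN.
Qed.

(** * Stability from decidable subsets *)

Lemma nn_myhill_stable (X : Type) (P : Prop) (S T D : X -> bool)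
    (f g : X -> X) (c : nat -> X) :
  markov_principle -> nn_myhill X -> injective f -> injective g ->
  (forall x, S x = T (f x)) -> (forall x, T x = S (g x)) ->
  (forall y, T y -> exists n, y = c n) ->
  (forall x, D x -> P) -> (P -> exists2 x, S x & D x) -> ~ ~ P -> P.
Proof.
move=> HMP HX f_inj g_inj Sf Tg Tc DP PD nnP.
have stable_bool (U : X -> bool) : nn_stable U.
  by move=> x; case: (U x) => // nnU; case: nnU.
have [||h [[k hk kh] [ST _ _]]] :=
  HX S T (stable_bool S) (stable_bool T) f g f_inj g_inj.
- by move=> x; rewrite Sf.
- by move=> x; rewrite Tg.
(* [D] marks the extra point and [c] enumerates a superset of [T]. If [P] holds, the extra point is
   [k (c n)] for some [n], so the sequence is not constantly false. *)
case: (HMP (fun n => D (k (c n)))) => [D0|n /DP //].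
apply: nnP => /PD[x Sx Dx].
have [n hx] := Tc _ (ST _ Sx).
by have := D0 n; rewrite -hx hk Dx.
Qed.

(** A parity-preserving injection that vacates 1, making room for one more odd element; [shift_even]
    likewise vacates 0. *)
Definition shift_odd n := if odd n then n.+2 else n.
Definition shift_even n := if odd n then n else n.+2.

Lemma odd_shift_odd n : odd (shift_odd n) = odd n.
Proof. by rewrite /shift_odd; case: ifP => //= ->. Qed.

Lemma odd_shift_even n : odd (shift_even n) = odd n.
Proof. by rewrite /shift_even; case: ifP => //= ->. Qed.

Lemma shift_odd_inj : injective shift_odd.
Proof.
move=> m n e; have := congr1 odd e; rewrite !odd_shift_odd => eo.
by move: e; rewrite /shift_odd eo; case: ifP => // _ [].
Qed.

Lemma shift_even_inj : injective shift_even.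
Proof.
move=> m n e; have := congr1 odd e; rewrite !odd_shift_even => eo.
by move: e; rewrite /shift_even eo; case: ifP => // _ [].
Qed.

Lemma shift_odd_neq1 n : shift_odd n <> 1.
Proof. by case: n => [|n] //; rewrite /shift_odd; case: ifP => // + [e]; rewrite e. Qed.

Lemma shift_even_neq0 n : shift_even n <> 0.
Proof. by case: n => [|n] //; rewrite /shift_even; case: ifP. Qed.

Lemma sum_nn_myhill_stable (P : Prop) :
  markov_principle -> nn_myhill (option P + nat)%type -> ~ ~ P -> P.
Proof.
move=> HMP HX.
(* The extra point [inl (Some _)] lies in [S], so it is sent to the vacated odd number 1. *)
pose f (x : option P + nat) : option P + nat :=
  match x with
  | inl (Some _) => inr 1
  | inl None => inl None
  | inr n => inr (shift_odd n)
  end.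
(* The extra point is outside [T] and must leave [S]: it pushes [inl None] off its place, which
   moves to the vacated even number 0. *)
pose g (x : option P + nat) : option P + nat :=
  match x with
  | inl (Some _) => inl None
  | inl None => inr 0
  | inr n => inr (shift_even n)
  end.
apply: (@nn_myhill_stable _ P
  (fun x => match x with inl (Some _) => true | inl None => false
            | inr n => odd n end)
  (fun x => match x with inl _ => false | inr n => odd n end)
  (fun x => match x with inl (Some _) => true | _ => false end)
  f g inr HMP HX).
- move=> [[u|]|m] [[v|]|n] //=.
  + by rewrite (proof_irrelevance _ u v).
  + by case=> /esym/shift_odd_neq1.
  + by case=> /shift_odd_neq1.
  + by case=> /shift_odd_inj ->.
- move=> [[u|]|m] [[v|]|n] //=.
  + by rewrite (proof_irrelevance _ u v).
  + by case=> /esym/shift_even_neq0.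
  + by case=> /shift_even_neq0.
  + by case=> /shift_even_inj ->.
- by move=> [[u|]|n] //=; rewrite odd_shift_odd.
- by move=> [[u|]|n] //=; rewrite odd_shift_even.
- by move=> [//|n] _; exists n.
- by move=> [[u|]|n].
- by move=> u; exists (inl (Some u)).
Qed.

Lemma prod_nn_myhill_stable (P : Prop) :
  markov_principle -> nn_myhill (option P * nat)%type -> ~ ~ P -> P.
Proof.
move=> HMP HX.
(* The extra point is [(Some _, 0)]; the rest of its row is outside [S] and [T] and can stay
   fixed. *)
pose f (x : option P * nat) : option P * nat :=
  match x with
  | (Some _, 0) => (None, 1)
  | (Some u, n.+1) => (Some u, n.+1)
  | (None, n) => (None, shift_odd n)
  end.
(* Shifting the [Some] row up by one takes all of it out of [S]. *)
pose g (x : option P * nat) : option P * nat :=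
  match x with
  | (Some u, n) => (Some u, n.+1)
  | (None, n) => (None, n)
  end.
apply: (@nn_myhill_stable _ P
  (fun x => match x with (Some _, n) => n == 0 | (None, n) => odd n end)
  (fun x => match x with (Some _, _) => false | (None, n) => odd n end)
  (fun x => match x with (Some _, _) => true | _ => false end)
  f g (pair None) HMP HX).
- have fN n : f (None, n) = (None, shift_odd n) by case: n.
  move=> [[u|] m] [[v|] n]; rewrite ?fN.
  + by rewrite (proof_irrelevance _ u v); case: m n => [|m] [|n] //= [->].
  + by case: m => [|m] //= [] /esym/shift_odd_neq1.
  + by case: n => [|n] //= [] /shift_odd_neq1.
  + by case=> /shift_odd_inj ->.
- move=> [[u|] m] [[v|] n] //= [->] //.
  by rewrite (proof_irrelevance _ u v).
- by move=> [[u|] [|n]] //=; rewrite odd_shift_odd.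
- by move=> [[u|] n].
- by move=> [[u|] n] //; exists n.
- by move=> [[u|] n].
- by move=> u; exists (Some u, 0).
Qed.

Theorem corollary63
  (HMP : markov_principle)
  (HAB : forall A B : Type, nn_strong_myhill A -> nn_strong_myhill B ->
           nn_myhill (A + B)%type \/ nn_myhill (A * B)%type) :
  forall p : Prop, p \/ ~ p.
Proof.
have stable (P : Prop) : ~ ~ P -> P.
  have := option_nn_strong_myhill (proof_irrelevance P).
  case/(HAB (option P) nat)/(_ nat_nn_strong_myhill).
  - exact: sum_nn_myhill_stable.
  - exact: prod_nn_myhill_stable.
by move=> p; apply: stable => nem; case: (nem); right=> hp; apply: nem; left.
Qed.
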